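(* Let $c \in \mathbb{R}^n$, let $Q$ be a real symmetric $n \times n$ matrix, let $\sigma > 0$, and let $m(s) = c^T s + \frac12 s^T Q s + \frac13 \sigma \|s\|^3$ for $s \in \mathbb{R}^n$. Let $k$ be the number of distinct negative eigenvalues of $Q$. Then a global minimizer of $m$ over $\mathbb{R}^n$ can be obtained by computing at most $2(k+1)$ stationary points of $m$. Namely, assume that stationary points of $m$ can be computed in a finite number of iterations by a local algorithm, and consider the following iterative strategy. Compute a stationary point $\bar s$ of $m$ by some local algorithm and check the conditions (A) and (B) given in the context. If none of them is satisfied, then $\bar s$ is a global minimizer of $m$; otherwise, the escape step described in the context gives a new point $\hat s$ such that $m(\hat s) < m(\bar s)$ and, starting from $\hat s$, compute a new stationary point and iterate. This procedure is finite and returns a global minimizer of $m$.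
   Context: $\|\cdot\|$ is the Euclidean norm and $I$ is the $n \times n$ identity matrix. A point $s^* \in \mathbb{R}^n$ is called a stationary point of $m$ if $\nabla m(s^* ) = c + Q s^* + \sigma \|s^*\| s^* = 0$. For a stationary point $\bar s$, the conditions are: (A) $c^T \bar s > 0$; (B) $c^T \bar s \le 0$ and there exists $d \in \mathbb{R}^n$ with $d^T (Q + \sigma \|\bar s\| I) d < 0$. The escape step from a stationary point $\bar s$ satisfying (A) or (B) produces a point $\hat s$ as follows. In case (A), $\hat s := -\bar s$. In case (B), with $d$ such that $d^T (Q + \sigma \|\bar s\| I) d < 0$: (i) if $\bar s = 0$, then $\hat s := \bar s + \alpha d$ with $0 < \alpha < -\frac{3\, d^T Q d}{2 \sigma \|d\|^3}$; (ii) if $\bar s \ne 0$ and $\bar s^T d \ne 0$, then $\hat s := \bar s - 2 \frac{\bar s^T d}{\|d\|^2} d$; (iii) if $\bar s \neq 0$ and $\bar s^T d = 0$, then $\hat s := \bar s - 2 \frac{\bar s^T z}{\|z\|^2} z$, where $z := \bar s + \alpha d$ and $$\alpha > \frac{c^T d - \sqrt{(c^T d)^2 + (c^T \bar s)[d^T (Q + \sigma \|\bar s\| I) d]}}{d^T (Q + \sigma \|\bar s\| I) d}.$$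
   Formalization: The local algorithm is additionally assumed to be monotone: the stationary point it computes has a value of m not above the value at its starting point; without this the procedure could cycle forever and would not be finite. *)

(* Defs.v *)
From HB Require Import structures.
From mathcomp Require Import all_boot all_order all_algebra.
From mathcomp Require Import boolp classical_sets functions cardinality reals.

Set Implicit Arguments.
Unset Strict Implicit.
Unset Printing Implicit Defensive.

Import Order.TTheory GRing.Theory Num.Theory.

Local Open Scope classical_set_scope.
Local Open Scope card_scope.
Local Open Scope ring_scope.

(* [u^T v], read off the 1 x 1 matrix product. *)
Definition dot (R : realType) (n : nat) (u v : 'cV[R]_n) : R :=
  (u^T *m v) 0 0.

(* [d^T A d] *)
Definition quad (R : realType) (n : nat) (A : 'M[R]_n) (d : 'cV[R]_n) : R :=
  (d^T *m A *m d) 0 0.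

(* The library's [`|u|] on matrices is the max norm, hence this definition. *)
Definition enorm (R : realType) (n : nat) (u : 'cV[R]_n) : R :=
  Num.sqrt (dot u u).

Definition neg_eigenvalues (R : realType) (n : nat) (Q : 'M[R]_n) : set R :=
  [set a | eigenvalue Q a /\ a < 0].

Definition cubic_model (R : realType) (n : nat) (c : 'cV[R]_n) (Q : 'M[R]_n)
    (sigma : R) (s : 'cV[R]_n) : R :=
  dot c s + 2^-1 * quad Q s + 3^-1 * sigma * enorm s ^+ 3.

Definition grad_cubic (R : realType) (n : nat) (c : 'cV[R]_n) (Q : 'M[R]_n)
    (sigma : R) (s : 'cV[R]_n) : 'cV[R]_n :=
  c + Q *m s + (sigma * enorm s) *: s.

Definition stationary (R : realType) (n : nat) (c : 'cV[R]_n) (Q : 'M[R]_n)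
    (sigma : R) (s : 'cV[R]_n) : Prop :=
  grad_cubic c Q sigma s = 0.

Definition global_minimizer (R : realType) (n : nat) (c : 'cV[R]_n)
    (Q : 'M[R]_n) (sigma : R) (s : 'cV[R]_n) : Prop :=
  forall x : 'cV[R]_n, cubic_model c Q sigma s <= cubic_model c Q sigma x.

(* [Q + sigma ||s|| I] *)
Definition shifted (R : realType) (n : nat) (Q : 'M[R]_n) (sigma : R)
    (s : 'cV[R]_n) : 'M[R]_n :=
  Q + (sigma * enorm s)%:M.

Definition condA (R : realType) (n : nat) (c s : 'cV[R]_n) : Prop :=
  0 < dot c s.

Definition condB (R : realType) (n : nat) (c : 'cV[R]_n) (Q : 'M[R]_n)
    (sigma : R) (s : 'cV[R]_n) : Prop :=
  dot c s <= 0 /\ exists d : 'cV[R]_n, quad (shifted Q sigma s) d < 0.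

(* [s - 2 (s^T d / ||d||^2) d] *)
Definition reflect_along (R : realType) (n : nat) (s d : 'cV[R]_n) : 'cV[R]_n :=
  s - (2 * (dot s d / enorm d ^+ 2)) *: d.

(* [escapeB c Q sigma s d sh]: [sh] is a possible outcome of the escape step
   from [s] under condition (B), using the negative curvature direction [d].
   It is a relation because the step length [alpha] is only constrained to an
   interval. *)
Inductive escapeB (R : realType) (n : nat) (c : 'cV[R]_n) (Q : 'M[R]_n)
    (sigma : R) (s d : 'cV[R]_n) : 'cV[R]_n -> Prop :=
| escapeB_zero (alpha : R) :
    s = 0 ->
    0 < alpha ->
    alpha < - ((3 * quad Q d) / (2 * sigma * enorm d ^+ 3)) ->
    escapeB c Q sigma s d (s + alpha *: d)
| escapeB_nonorth :
    s <> 0 ->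
    dot s d <> 0 ->
    escapeB c Q sigma s d (reflect_along s d)
| escapeB_orth (alpha : R) :
    s <> 0 ->
    dot s d = 0 ->
    (dot c d - Num.sqrt (dot c d ^+ 2
                         + dot c s * quad (shifted Q sigma s) d))
      / quad (shifted Q sigma s) d < alpha ->
    escapeB c Q sigma s d (reflect_along s (s + alpha *: d)).

Definition escape (R : realType) (n : nat) (c : 'cV[R]_n) (Q : 'M[R]_n)
    (sigma : R) (s sh : 'cV[R]_n) : Prop :=
  (condA c s /\ sh = - s) \/
  (dot c s <= 0 /\
   exists d : 'cV[R]_n,
     quad (shifted Q sigma s) d < 0 /\ escapeB c Q sigma s d sh).

Definition first_stationary (R : realType) (n : nat) (c : 'cV[R]_n)
    (Q : 'M[R]_n) (sigma : R) (u : nat -> 'cV[R]_n) (N : nat) : Prop :=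
  stationary c Q sigma (u N) /\
  forall i : nat, (i < N)%N -> ~ stationary c Q sigma (u i).

(* [L x u] means that [u] is a sequence of iterates the local method may
   generate when started at [x]; a relation leaves room for nondeterminism and
   for using different methods from one call to the next. The method can be
   started anywhere, reaches a stationary point after finitely many iterations,
   and stops there at a value of the model not above the initial one; without
   this last requirement the outer iteration could cycle. *)
Definition local_algorithm (R : realType) (n : nat) (c : 'cV[R]_n)
    (Q : 'M[R]_n) (sigma : R) (L : 'cV[R]_n -> (nat -> 'cV[R]_n) -> Prop)
    : Prop :=
  [/\ forall x, exists u, L x u,
      forall x u, L x u -> u 0%N = x,
      forall x u, L x u -> exists N : nat, stationary c Q sigma (u N)
    & forall x u (N : nat), L x u -> first_stationary c Q sigma u N ->
        cubic_model c Q sigma (u N) <= cubic_model c Q sigma x].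

Definition local_output (R : realType) (n : nat) (c : 'cV[R]_n)
    (Q : 'M[R]_n) (sigma : R) (L : 'cV[R]_n -> (nat -> 'cV[R]_n) -> Prop)
    (x y : 'cV[R]_n) : Prop :=
  exists (u : nat -> 'cV[R]_n) (N : nat),
    [/\ L x u, first_stationary c Q sigma u N & y = u N].

(* [strategy c Q sigma L x0 j s]: an execution of the strategy from [x0] may
   have computed exactly [j] stationary points so far, the last one being
   [s]. *)
Inductive strategy (R : realType) (n : nat) (c : 'cV[R]_n) (Q : 'M[R]_n)
    (sigma : R) (L : 'cV[R]_n -> (nat -> 'cV[R]_n) -> Prop) (x0 : 'cV[R]_n)
    : nat -> 'cV[R]_n -> Prop :=
| strategy_start (s : 'cV[R]_n) :
    local_output c Q sigma L x0 s -> strategy c Q sigma L x0 1 s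
| strategy_next (j : nat) (s sh s' : 'cV[R]_n) :
    strategy c Q sigma L x0 j s ->
    escape c Q sigma s sh ->
    local_output c Q sigma L sh s' ->
    strategy c Q sigma L x0 j.+1 s'.

Definition strategy_returns (R : realType) (n : nat) (c : 'cV[R]_n)
    (Q : 'M[R]_n) (sigma : R) (L : 'cV[R]_n -> (nat -> 'cV[R]_n) -> Prop)
    (x0 : 'cV[R]_n) (j : nat) (s : 'cV[R]_n) : Prop :=
  [/\ strategy c Q sigma L x0 j s, ~ condA c s & ~ condB c Q sigma s].

(* Main.v *)
Require Import Defs.
From HB Require Import structures.
From mathcomp Require Import all_boot all_order all_algebra.
From mathcomp Require Import boolp classical_sets functions cardinality reals.
From mathcomp Require Import ring lra spectral sesquilinear complex.

Set Implicit Arguments.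
Unset Strict Implicit.
Unset Printing Implicit Defensive.

Import Order.TTheory GRing.Theory Num.Theory.

Local Open Scope classical_set_scope.
Local Open Scope card_scope.
Local Open Scope ring_scope.

(** Expanding [m] at a stationary point [s] with the help of the gradient
    equation gives
      m(x) - m(s) = (x - s)^T (Q + sigma ||s|| I) (x - s) / 2
                    + sigma (||x|| - ||s||)^2 (2 ||x|| + ||s||) / 6.
    Hence [s] is a global minimizer when the shifted matrix is positive
    semidefinite, reflecting [s] along a direction of negative curvature
    decreases [m], and the value of [m] at a stationary point depends only on
    its norm. The stationary points visited therefore have distinct norms.
    In an eigenbasis of [Q], with [g] the coordinates of [c], the norms are
    encoded by the solutions [l = sigma ||s|| > 0] of the secular equation
      sum_j g_j^2 / (l (d_j + l))^2 = 1 / sigma^2,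
    whose left-hand side is strictly convex between two consecutive poles
    [- d_j], so that among three solutions some pole separates the extreme ones.
    The [k] possible poles cut the half-line in [k + 1] pieces, each with at
    most two norms. *)

(** * Euclidean inner product, norm and quadratic forms *)

Lemma dotE (R : realType) (n : nat) (u v : 'cV[R]_n) :
  dot u v = \sum_i u i 0 * v i 0.
Proof. by rewrite /dot mxE; apply: eq_bigr => i _; rewrite mxE. Qed.

Lemma dotC (R : realType) (n : nat) (u v : 'cV[R]_n) : dot u v = dot v u.
Proof. by rewrite !dotE; apply: eq_bigr => i _; rewrite mulrC. Qed.

Lemma dotDr (R : realType) (n : nat) (u v w : 'cV[R]_n) :
  dot u (v + w) = dot u v + dot u w.
Proof. by rewrite /dot mulmxDr mxE. Qed.

Lemma dotZr (R : realType) (n : nat) (a : R) (u v : 'cV[R]_n) :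
  dot u (a *: v) = a * dot u v.
Proof. by rewrite /dot -scalemxAr mxE. Qed.

Lemma dotNr (R : realType) (n : nat) (u v : 'cV[R]_n) : dot u (- v) = - dot u v.
Proof. by rewrite -scaleN1r dotZr mulN1r. Qed.

Lemma dot0r (R : realType) (n : nat) (u : 'cV[R]_n) : dot u 0 = 0.
Proof. by rewrite -(scale0r 0) dotZr mul0r. Qed.

Lemma dotDl (R : realType) (n : nat) (u v w : 'cV[R]_n) :
  dot (v + w) u = dot v u + dot w u.
Proof. by rewrite !(dotC _ u) dotDr. Qed.

Lemma dotZl (R : realType) (n : nat) (a : R) (u v : 'cV[R]_n) :
  dot (a *: v) u = a * dot v u.
Proof. by rewrite !(dotC _ u) dotZr. Qed.

Lemma dotNl (R : realType) (n : nat) (u v : 'cV[R]_n) : dot (- v) u = - dot v u.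
Proof. by rewrite !(dotC _ u) dotNr. Qed.

Lemma dot_mulmx (R : realType) (m n : nat) (A : 'M[R]_(m, n)) (u : 'cV[R]_m)
    (v : 'cV[R]_n) : dot u (A *m v) = dot (A^T *m u) v.
Proof. by rewrite /dot trmx_mul trmxK mulmxA. Qed.

Lemma dot_sym (R : realType) (n : nat) (A : 'M[R]_n) (u v : 'cV[R]_n) :
  A^T = A -> dot u (A *m v) = dot v (A *m u).
Proof. by move=> Asym; rewrite dot_mulmx Asym dotC. Qed.

Lemma dot_ge0 (R : realType) (n : nat) (u : 'cV[R]_n) : 0 <= dot u u.
Proof. by rewrite dotE sumr_ge0 // => i _; rewrite -expr2 sqr_ge0. Qed.

Lemma dot_eq0 (R : realType) (n : nat) (u : 'cV[R]_n) :
  (dot u u == 0) = (u == 0).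
Proof.
apply/eqP/eqP => [|->]; last exact: dot0r.
rewrite dotE => /psumr_eq0P u0; apply/colP => i; rewrite mxE.
by apply/eqP; rewrite -sqrf_eq0 expr2 u0 // => j _; rewrite -expr2 sqr_ge0.
Qed.

Lemma enorm_ge0 (R : realType) (n : nat) (u : 'cV[R]_n) : 0 <= enorm u.
Proof. exact: sqrtr_ge0. Qed.

Lemma sqr_enorm (R : realType) (n : nat) (u : 'cV[R]_n) :
  enorm u ^+ 2 = dot u u.
Proof. by rewrite sqr_sqrtr ?dot_ge0. Qed.

Lemma enorm0 (R : realType) (n : nat) : enorm (0 : 'cV[R]_n) = 0.
Proof. by rewrite /enorm dot0r sqrtr0. Qed.

Lemma enorm_eq0 (R : realType) (n : nat) (u : 'cV[R]_n) :
  (enorm u == 0) = (u == 0).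
Proof. by rewrite -sqrf_eq0 sqr_enorm dot_eq0. Qed.

Lemma enormZ (R : realType) (n : nat) (a : R) (u : 'cV[R]_n) :
  0 <= a -> enorm (a *: u) = a * enorm u.
Proof.
move=> a0; rewrite /enorm dotZl dotZr mulrA -expr2 sqrtrM ?sqr_ge0 //.
by rewrite sqrtr_sqr ger0_norm.
Qed.

Lemma enorm_gt0 (R : realType) (n : nat) (u : 'cV[R]_n) :
  u != 0 -> 0 < enorm u.
Proof. by move=> u0; rewrite lt0r enorm_ge0 enorm_eq0 u0. Qed.

Lemma quadE (R : realType) (n : nat) (A : 'M[R]_n) (d : 'cV[R]_n) :
  quad A d = dot d (A *m d).
Proof. by rewrite /quad /dot mulmxA. Qed.

Lemma quadZ (R : realType) (n : nat) (A : 'M[R]_n) (a : R) (d : 'cV[R]_n) :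
  quad A (a *: d) = a ^+ 2 * quad A d.
Proof. by rewrite !quadE dotZl -scalemxAr dotZr mulrA. Qed.

Lemma quadD (R : realType) (n : nat) (A : 'M[R]_n) (u v : 'cV[R]_n) :
  A^T = A -> quad A (u + v) = quad A u + 2 * dot v (A *m u) + quad A v.
Proof.
by move=> Asym; rewrite !quadE mulmxDr dotDl !dotDr (dot_sym u v Asym); ring.
Qed.

Lemma quad_neq0 (R : realType) (n : nat) (A : 'M[R]_n) (d : 'cV[R]_n) :
  quad A d < 0 -> d != 0.
Proof. by apply: contraTneq => ->; rewrite quadE mulmx0 dot0r ltxx. Qed.

(** * Expansion at a stationary point and global optimality *)

Lemma shifted_sym (R : realType) (n : nat) (Q : 'M[R]_n) (sigma : R)
    (s : 'cV[R]_n) : Q^T = Q -> (shifted Q sigma s)^T = shifted Q sigma s.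
Proof. by move=> Qsym; rewrite /shifted linearD /= tr_scalar_mx Qsym. Qed.

Lemma stationary_shifted (R : realType) (n : nat) (c : 'cV[R]_n)
    (Q : 'M[R]_n) (sigma : R) (s : 'cV[R]_n) :
  stationary c Q sigma s -> shifted Q sigma s *m s = - c.
Proof.
move=> st; apply/eqP; rewrite -addr_eq0 /shifted mulmxDl mul_scalar_mx addrC.
by rewrite addrA; apply/eqP.
Qed.

Lemma cubic_model_sub (R : realType) (n : nat) (c : 'cV[R]_n) (Q : 'M[R]_n)
    (sigma : R) (s x : 'cV[R]_n) :
  Q^T = Q -> stationary c Q sigma s ->
  cubic_model c Q sigma x - cubic_model c Q sigma s =
  2^-1 * quad (shifted Q sigma s) (x - s)
  + 6^-1 * sigma * (enorm x - enorm s) ^+ 2 * (2 * enorm x + enorm s).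
Proof.
move=> Qsym st.
have quad_shifted y : quad (shifted Q sigma s) y =
    quad Q y + sigma * enorm s * enorm y ^+ 2.
  by rewrite !quadE /shifted mulmxDl dotDr mul_scalar_mx dotZr sqr_enorm.
have quad_s : quad (shifted Q sigma s) s = - dot c s.
  by rewrite quadE (stationary_shifted st) dotNr dotC.
have quad_Qs : quad Q s = - dot c s - sigma * enorm s * enorm s ^+ 2.
  by rewrite -quad_s quad_shifted addrK.
rewrite quadD ?shifted_sym // dotNl (dot_sym _ _ (shifted_sym _ _ Qsym)).
rewrite (stationary_shifted st) dotNr -scaleN1r quadZ quad_s quad_shifted.
(* With [X = enorm x] and [S = enorm s], what is left is [sigma / 6] times [2 X^3 - 3 S X^2 + S^3 =
   (X - S)^2 (2 X + S)]. *)
by rewrite /cubic_model quad_Qs (dotC x c); field.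
Qed.

(** Without (A), [dot c s <= 0] holds, so (B) can fail only if the shifted matrix is positive
    semidefinite; both terms of [cubic_model_sub] are then nonnegative. *)
Lemma stationary_global_minimizer (R : realType) (n : nat) (c : 'cV[R]_n)
    (Q : 'M[R]_n) (sigma : R) (s : 'cV[R]_n) :
  Q^T = Q -> 0 < sigma -> stationary c Q sigma s ->
  ~ condA c s -> ~ condB c Q sigma s -> global_minimizer c Q sigma s.
Proof.
move=> Qsym sigma_gt0 st nA nB x.
rewrite -subr_ge0 (cubic_model_sub _ Qsym st) addr_ge0 //; last first.
  apply: mulr_ge0; last by rewrite addr_ge0 ?mulr_ge0 ?enorm_ge0.
  by rewrite mulr_ge0 ?sqr_ge0 // mulr_ge0 ?invr_ge0 // ltW.
rewrite mulr_ge0 ?invr_ge0 // leNgt; apply/negP => neg; apply: nB; split.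
  by rewrite leNgt; apply/negP.
by exists (x - s).
Qed.

(** * The escape step: strict decrease and existence *)

Lemma enorm_reflect_along (R : realType) (n : nat) (s d : 'cV[R]_n) :
  d != 0 -> enorm (reflect_along s d) = enorm s.
Proof.
move=> d0; have dd0 : dot d d != 0 by rewrite dot_eq0.
rewrite /enorm /reflect_along sqr_enorm; congr Num.sqrt.
rewrite !(dotDl, dotDr, dotNl, dotNr, dotZl, dotZr) (dotC d s).
by field.
Qed.

(** A reflection keeps the norm, so the second term of [cubic_model_sub] vanishes, and the
    displacement is a nonzero multiple of [d]. *)
Lemma cubic_model_reflect_along (R : realType) (n : nat) (c : 'cV[R]_n)
    (Q : 'M[R]_n) (sigma : R) (s d : 'cV[R]_n) :
  Q^T = Q -> stationary c Q sigma s -> dot s d != 0 ->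
  quad (shifted Q sigma s) d < 0 ->
  cubic_model c Q sigma (reflect_along s d) < cubic_model c Q sigma s.
Proof.
move=> Qsym st sd neg; have d0 := quad_neq0 neg.
rewrite -subr_lt0 (cubic_model_sub _ Qsym st) enorm_reflect_along // subrr.
rewrite expr0n mulr0 mul0r addr0 pmulr_rlt0 ?invr_gt0 //.
rewrite /reflect_along addrAC subrr add0r.
rewrite -scaleNr quadZ pmulr_rlt0 // exprn_even_gt0 //= oppr_eq0.
by rewrite mulf_neq0 ?pnatr_eq0 // mulf_neq0 // invr_eq0 sqrf_eq0 enorm_eq0.
Qed.

(* The quadratic is concave and [(p - sqrt (p^2 + r q)) / q] is the larger of
   its two roots, since [q < 0]. *)
Lemma quadratic_lt0 (R : realType) (p q r a : R) :
  q < 0 -> r <= 0 -> (p - Num.sqrt (p ^+ 2 + r * q)) / q < a ->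
  q * a ^+ 2 - 2 * p * a - r < 0.
Proof.
move=> q0 r0; rewrite ltr_ndivrMr //.
have D0 : 0 <= p ^+ 2 + r * q by have := sqr_ge0 p; nra.
have := sqr_sqrtr D0; have := sqrtr_ge0 (p ^+ 2 + r * q).
(* Multiplied by [q < 0], the trinomial becomes [(q a - p)^2 - w^2], while the hypothesis reads
   [q a - p < - w]. *)
move: (Num.sqrt _) => w w0 wE lt_w; nra.
Qed.

Lemma escapeB_lt (R : realType) (n : nat) (c : 'cV[R]_n) (Q : 'M[R]_n)
    (sigma : R) (s d sh : 'cV[R]_n) :
  Q^T = Q -> 0 < sigma -> stationary c Q sigma s -> dot c s <= 0 ->
  quad (shifted Q sigma s) d < 0 -> escapeB c Q sigma s d sh ->
  cubic_model c Q sigma sh < cubic_model c Q sigma s.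
Proof.
move=> Qsym sigma_gt0 st cs neg; have d0 := quad_neq0 neg.
case=> [alpha s0 alpha_gt0 | s0 | alpha s0].
- have H0 : shifted Q sigma s = Q.
    by rewrite /shifted s0 enorm0 mulr0 raddf0 addr0.
  have d_gt0 := enorm_gt0 d0.
  rewrite -mulNr ltr_pdivlMr ?mulr_gt0 // => alpha_lt.
  rewrite -subr_lt0 (cubic_model_sub _ Qsym st) s0 add0r subr0 enorm0 -s0 H0.
  rewrite quadZ enormZ ?ltW //.
  have -> : 2^-1 * (alpha ^+ 2 * quad Q d) + 6^-1 * sigma *
      (alpha * enorm d - 0) ^+ 2 * (2 * (alpha * enorm d) + 0) =
      6^-1 * alpha ^+ 2 * (3 * quad Q d + alpha * (2 * sigma * enorm d ^+ 3)).
    by field.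
  by rewrite pmulr_rlt0 ?mulr_gt0 ?exprn_gt0 //; lra.
- by move=> /eqP sd; apply: cubic_model_reflect_along.
(* The orthogonal case reduces to the previous one: [z = s + alpha *: d] has [dot s z = dot s s],
   and its curvature is the trinomial of [quadratic_lt0] with [p = dot c d] and [r = dot c s]. *)
move=> sd alpha_gt; apply: cubic_model_reflect_along => //.
  by rewrite dotDr dotZr sd mulr0 addr0 dot_eq0; apply/eqP.
have := quadratic_lt0 neg cs alpha_gt; apply: le_lt_trans.
rewrite quadD ?shifted_sym // quadZ quadE dotZl (stationary_shifted st) !dotNr.
by rewrite (dotC s) (dotC d); lra.
Qed.

Lemma escape_lt (R : realType) (n : nat) (c : 'cV[R]_n) (Q : 'M[R]_n)
    (sigma : R) (s sh : 'cV[R]_n) :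
  Q^T = Q -> 0 < sigma -> stationary c Q sigma s -> escape c Q sigma s sh ->
  cubic_model c Q sigma sh < cubic_model c Q sigma s.
Proof.
move=> Qsym sigma_gt0 st [[A ->]|[cs [d [neg esc]]]]; last first.
  exact: escapeB_lt esc.
rewrite /cubic_model -scaleN1r dotZr quadZ scaleN1r.
have -> : enorm (- s) = enorm s by rewrite /enorm dotNl dotNr opprK.
by move: A; rewrite /condA; lra.
Qed.

Lemma escapeB_exists (R : realType) (n : nat) (c : 'cV[R]_n) (Q : 'M[R]_n)
    (sigma : R) (s d : 'cV[R]_n) :
  0 < sigma -> quad (shifted Q sigma s) d < 0 ->
  exists sh, escapeB c Q sigma s d sh.
Proof.
move=> sigma_gt0 neg; have d0 := quad_neq0 neg.
have [s0|/eqP s0] := eqVneq s 0; last first.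
  have [sd|/eqP sd] := eqVneq (dot s d) 0; last first.
    by exists (reflect_along s d); exact: escapeB_nonorth.
  eexists; apply: escapeB_orth => //.
  (* The step length is the lower bound plus one. *)
  by apply: (_ : forall x : R, x < x + 1) => x; rewrite ltrDl.
have := neg; rewrite /shifted s0 enorm0 mulr0 raddf0 addr0 => negQ.
have ub_gt0 : 0 < - ((3 * quad Q d) / (2 * sigma * enorm d ^+ 3)).
  rewrite oppr_gt0 pmulr_llt0 ?invr_gt0 ?mulr_gt0 ?exprn_gt0 ?enorm_gt0 //.
  by rewrite pmulr_rlt0.
(* Half of the positive upper bound serves as step length. *)
exists (0 + (- ((3 * quad Q d) / (2 * sigma * enorm d ^+ 3)) / 2) *: d).
apply: escapeB_zero => //; [exact: divr_gt0 | lra].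
Qed.

Lemma escape_exists (R : realType) (n : nat) (c : 'cV[R]_n) (Q : 'M[R]_n)
    (sigma : R) (s : 'cV[R]_n) :
  0 < sigma -> condA c s \/ condB c Q sigma s ->
  exists sh, escape c Q sigma s sh.
Proof.
move=> sigma_gt0 [A|[cs [d neg]]]; first by exists (- s); left.
have [sh esc] := escapeB_exists c sigma_gt0 neg.
by exists sh; right; split => //; exists d.
Qed.

(* Two stationary points of equal norm share their shifted matrix, so
   [cubic_model_sub] is symmetric in them. *)
Lemma cubic_model_eq_enorm (R : realType) (n : nat) (c : 'cV[R]_n)
    (Q : 'M[R]_n) (sigma : R) (s t : 'cV[R]_n) :
  Q^T = Q -> stationary c Q sigma s -> stationary c Q sigma t ->
  enorm s = enorm t -> cubic_model c Q sigma s = cubic_model c Q sigma t.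
Proof.
move=> Qsym sts stt est.
have := cubic_model_sub t Qsym sts; have := cubic_model_sub s Qsym stt.
rewrite /shifted est subrr -(opprB s t) -[- (s - t)]scaleN1r quadZ; lra.
Qed.

(** * Real eigenframe and the secular equation *)

(* The rows of [B] are the real and imaginary parts of a unitary basis of
   complex eigenvectors; some of them may be zero. *)
Lemma symmetric_eigenframe (R : realType) (n : nat) (Q : 'M[R]_n) :
  Q^T = Q -> exists (B : 'M[R]_(n + n, n)) (d : 'I_(n + n) -> R),
    B^T *m B = 1%:M /\ forall j, row j B *m Q = d j *: row j B.
Proof.
move=> Qsym; pose A : 'M[R[i]]_n := map_mx (real_complex R) Q.
have Aherm : A \is hermsymmx.
  apply: realsym_hermsym.
    by apply/is_hermitianmxP; rewrite expr0 scale1r map_mx_id // map_trmx Qsym.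
  apply/mxOverP => i j; rewrite mxE; exact/complex_realP/(ex_intro _ (Q i j)).
have /orthomx_spectralP AE := hermitian_normalmx Aherm.
have /mxOverP dreal := hermitian_spectral_diag_real Aherm.
move: (spectralmx A) (spectral_diag A) (spectral_unitarymx A) AE dreal => P sp.
move=> Punit AE dreal.
have PA : P *m A = diag_mx sp *m P.
  by rewrite AE -!mulmxA mulKVmx // unitarymx_unit.
have PP : (P^t* *m P = 1%:M)%sesqui.
  by rewrite -invmx_unitary // mulVmx ?unitarymx_unit.
have Re_sum (F : 'I_n -> R[i]) :
    complex.Re (\sum_k F k) = \sum_k complex.Re (F k).
  by apply: (@big_morph _ _ (@complex.Re R) 0 +%R 0 +%R) => // -[? ?] [? ?].
have Im_sum (F : 'I_n -> R[i]) :
    complex.Im (\sum_k F k) = \sum_k complex.Im (F k).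
  by apply: (@big_morph _ _ (@complex.Im R) 0 +%R 0 +%R) => // -[? ?] [? ?].
exists (col_mx (map_mx (@complex.Re R) P) (map_mx (@complex.Im R) P)).
(* As [Q] and its eigenvalues are real, the real and imaginary parts of an eigenvector share its
   eigenvalue; hence the list [d] occurs twice. *)
pose d : 'rV[R]_n := map_mx (@complex.Re R) sp.
exists (fun j => row_mx d d 0 j); split.
  (* [B^T *m B] is the real part of the adjoint of [P] times [P]. *)
  rewrite tr_col_mx mul_row_col; apply/matrixP => i j.
  have /matrixP/(_ i j) := PP; rewrite !mxE => /(congr1 (@complex.Re R)).
  rewrite Re_sum -big_split /= => PPij.
  transitivity (complex.Re ((i == j)%:R : R[i])); last by case: (i == j).
  rewrite -PPij; apply: eq_bigr => k _; rewrite !mxE.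
  by case: (P k i) (P k j) => [a b] [a' b'] /=; ring.
have PAE k m : \sum_l P k l * (Q l m)%:C%C = (d 0 k)%:C%C * P k m.
  transitivity ((P *m A) k m).
    by rewrite mxE; under [RHS]eq_bigr do rewrite mxE.
  by rewrite PA mul_diag_mx !mxE RRe_real.
move=> j; apply/rowP => m; rewrite !mxE.
case: (split_ordP j) => k ->; rewrite ?row_mxEl ?row_mxEr ?col_mxEu ?col_mxEd.
  have := congr1 (@complex.Re R) (PAE k m); rewrite Re_sum.
  have -> :
    complex.Re ((d 0 k)%:C%C * P k m) =
    d 0 k * map_mx (@complex.Re R) P k m.
    by rewrite !mxE; case: (P k m) => a b /=; ring.
  by move<-; apply: eq_bigr => l _; rewrite mxE col_mxEu mxE;
    case: (P k l) => a b /=; ring.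
have := congr1 (@complex.Im R) (PAE k m); rewrite Im_sum.
have -> :
    complex.Im ((d 0 k)%:C%C * P k m) =
    d 0 k * map_mx (@complex.Im R) P k m.
  by rewrite !mxE; case: (P k m) => a b /=; ring.
by move<-; apply: eq_bigr => l _; rewrite mxE col_mxEd mxE;
  case: (P k l) => a b /=; ring.
Qed.

(** Parseval's identity for the frame formed by the rows of [B]. *)
Lemma eigenframe_dot (R : realType) (m n : nat) (B : 'M[R]_(m, n))
    (s : 'cV[R]_n) :
  B^T *m B = 1%:M -> \sum_j (B *m s) j 0 ^+ 2 = enorm s ^+ 2.
Proof.
move=> BB; have BBs : dot s s = dot s (B^T *m B *m s) by rewrite BB mul1mx.
rewrite sqr_enorm BBs -mulmxA dot_mulmx trmxK dotE.
by apply: eq_bigr => j _; rewrite expr2.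
Qed.

(* The tangent at [p = q = 1] of the convex function [(p q)^-2]. *)
Lemma tangent_inv_sqr (R : realType) (p q : R) :
  0 < p -> 0 < q -> p != 1 -> (5 - 2 * p - 2 * q) * (p * q) ^+ 2 < 1.
Proof.
move=> p0 q0 p1; pose h := (p + q) / 2; have h0 : 0 < h by rewrite /h; lra.
have pq_gt0 : 0 < p * q by exact: mulr_gt0.
(* By the AM-GM inequality, when [5 - 4 * h] is nonnegative it suffices to compare
   [(5 - 4 * h) * h ^+ 4] with 1. *)
have pq_le : p * q <= h ^+ 2.
  rewrite -subr_ge0 (_ : _ - _ = ((p - q) / 2) ^+ 2) ?sqr_ge0 //.
  by rewrite /h; field.
have -> : 5 - 2 * p - 2 * q = 5 - 4 * h by rewrite /h; field.
have [neg|pos] := ltP (5 - 4 * h) 0.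
  by apply: (@lt_trans _ _ 0) => //; rewrite pmulr_llt0 // exprn_gt0.
have pq2_le : (p * q) ^+ 2 <= h ^+ 4.
  by rewrite (exprM h 2 2) ler_pXn2r ?nnegrE ?sqr_ge0 // ltW.
(* At [h = 1] the bound in [h] is an equality; strictness comes from [p * q = 1 - (1 - p) ^+ 2]. *)
have [h1|h1] := eqVneq h 1.
  have q_eq : q = 2 - p by move: h1; rewrite /h; lra.
  have : 0 < (1 - p) ^+ 2 by rewrite exprn_even_gt0 //= subr_eq0 eq_sym.
  rewrite h1 mulr1; move: pq_gt0; rewrite q_eq; nra.
apply: (le_lt_trans (ler_wpM2l pos pq2_le)); rewrite -subr_gt0.
have -> : 1 - (5 - 4 * h) * h ^+ 4 =
    (1 - h) ^+ 2 * (1 + 2 * h + 3 * h ^+ 2 + 4 * h ^+ 3) by ring.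
rewrite mulr_gt0 //; first by rewrite exprn_even_gt0 //= subr_eq0 eq_sym.
by have := exprn_gt0 2 h0; have := exprn_gt0 3 h0; lra.
Qed.

(** The tangent at [m] of a secular term, with [l] and [m] on the same side of the pole [- d].
    Scaling by the values at [m] reduces it to [tangent_inv_sqr]. *)
Lemma tangent_secular_term (R : realType) (d l m x y : R) :
  0 < l -> 0 < m -> l != m -> 0 < (d + l) * (d + m) -> y != 0 ->
  (d + l) * x = (d + m) * y ->
  (1 - 2 * (l - m) / m - 2 * (l - m) / (d + m)) * (y / m) ^+ 2 < (x / l) ^+ 2.
Proof.
move=> l0 m0 lm dlm y0 xy.
have dl0 : d + l != 0 by apply: contraTneq dlm => ->; rewrite mul0r ltxx.
have dm0 : d + m != 0 by apply: contraTneq dlm => ->; rewrite mulr0 ltxx.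
have [l_neq0 m_neq0] := (lt0r_neq0 l0, lt0r_neq0 m0).
pose p := l / m; pose q := (d + l) / (d + m).
have p0 : 0 < p by exact: divr_gt0.
have q0 : 0 < q.
  rewrite (_ : q = (d + l) * (d + m) / (d + m) ^+ 2); last by rewrite /q; field.
  by rewrite divr_gt0 // exprn_even_gt0.
have p1 : p != 1.
  by apply: contra lm => /eqP p1; rewrite -(divfK m_neq0 l) -/p p1 mul1r.
have x0 : x != 0.
  have := mulf_neq0 dm0 y0; rewrite -xy.
  by apply: contraNneq => ->; rewrite mulr0.
have -> : 1 - 2 * (l - m) / m - 2 * (l - m) / (d + m) = 5 - 2 * p - 2 * q.
  by rewrite /p /q; field; rewrite dm0 m_neq0.
have -> : (y / m) ^+ 2 = (p * q) ^+ 2 * (x / l) ^+ 2.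
  rewrite (_ : y = (d + l) * x / (d + m)); last first.
    by rewrite xy mulrAC divff // mul1r.
  by rewrite /p /q; field; rewrite dm0 l_neq0 m_neq0.
rewrite mulrA gtr_pMl ?tangent_inv_sqr //.
by rewrite exprn_even_gt0 //= mulf_neq0 // invr_eq0.
Qed.

(** The tangent at [l2] is compared with the values at [l1] and [l3]; in the combination with
    weights [l3 - l2] and [l2 - l1] the slopes cancel. *)
Lemma secular_term_convex (R : realType) (d g l1 l2 l3 x1 x2 x3 : R) :
  0 < l1 -> l1 < l2 -> l2 < l3 -> ~~ (l1 < - d <= l3) -> x2 != 0 ->
  g + (d + l1) * x1 = 0 -> g + (d + l2) * x2 = 0 -> g + (d + l3) * x3 = 0 ->
  (l3 - l1) * (x2 / l2) ^+ 2 <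
  (l3 - l2) * (x1 / l1) ^+ 2 + (l2 - l1) * (x3 / l3) ^+ 2.
Proof.
move=> l1_gt0 l12 l23 nopole x2_neq0 e1 e2 e3.
have [l2_gt0 l3_gt0] : 0 < l2 /\ 0 < l3 by lra.
have [dl1 dl3] : 0 < (d + l1) * (d + l2) /\ 0 < (d + l3) * (d + l2).
  have [|le1] := ltP l1 (- d).
    move=> lt1; move: nopole; rewrite lt1 /= -ltNge => lt3.
    by split; rewrite nmulr_rgt0; lra.
  (* A pole at [l1] itself would give [g = 0] by [e1], hence [x2 = 0] by [e2]. *)
  suff neq : - d != l1 by split; apply: mulr_gt0; lra.
  apply: contra x2_neq0 => /eqP d_eq; move: e1 e2.
  rewrite -d_eq subrr mul0r addr0 => ->; rewrite add0r => /eqP.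
  by rewrite mulf_eq0 => /orP[/eqP|//]; lra.
have t1 : (1 - 2 * (l1 - l2) / l2 - 2 * (l1 - l2) / (d + l2)) *
    (x2 / l2) ^+ 2 < (x1 / l1) ^+ 2.
  by apply: tangent_secular_term => //; lra.
have t3 : (1 - 2 * (l3 - l2) / l2 - 2 * (l3 - l2) / (d + l2)) *
    (x2 / l2) ^+ 2 < (x3 / l3) ^+ 2.
  by apply: tangent_secular_term => //; lra.
have w1 : 0 < l3 - l2 by lra.
have w3 : 0 < l2 - l1 by lra.
rewrite -(ltr_pM2l w1) in t1; rewrite -(ltr_pM2l w3) in t3.
apply: (le_lt_trans _ (ltrD t1 t3)); rewrite le_eqVlt; apply/orP; left.
apply/eqP; field.
by rewrite lt0r_neq0 //= ; apply: contraTneq dl1 => ->; rewrite mulr0 ltxx.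
Qed.

Lemma stationary_at0 (R : realType) (n : nat) (c : 'cV[R]_n) (Q : 'M[R]_n)
    (sigma : R) : stationary c Q sigma 0 -> c = 0.
Proof. by rewrite /stationary /grad_cubic mulmx0 scaler0 !addr0. Qed.

(* A pole [- d_j] with [g_j = 0] may itself be of the form [sigma ||s||] for a
   stationary point [s], hence the half-open interval. *)
Lemma stationary_triple_eigenvalue (R : realType) (n : nat) (c : 'cV[R]_n)
    (Q : 'M[R]_n) (sigma : R) (s1 s2 s3 : 'cV[R]_n) :
  Q^T = Q -> 0 < sigma -> stationary c Q sigma s1 -> stationary c Q sigma s2 ->
  stationary c Q sigma s3 -> enorm s1 < enorm s2 -> enorm s2 < enorm s3 ->
  exists a, eigenvalue Q a /\ sigma * enorm s1 < - a <= sigma * enorm s3.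
Proof.
move=> Qsym sigma_gt0 st1 st2 st3 s12 s23.
have n2_gt0 := le_lt_trans (enorm_ge0 s1) s12.
have n3_gt0 := lt_trans n2_gt0 s23.
have [s1_eq0|s1_neq0] := eqVneq s1 0.
  (* Here [c = 0], so [s3] is itself an eigenvector and the pole is the closed right end. *)
  exists (- (sigma * enorm s3)); rewrite opprK lexx s1_eq0 enorm0 mulr0.
  rewrite mulr_gt0 //; split => //; apply/eigenvalueP; exists s3^T.
    move: st3; rewrite s1_eq0 in st1; rewrite (stationary_at0 st1).
    rewrite /stationary /grad_cubic add0r => /eqP; rewrite addr_eq0 => /eqP Qs3.
    by rewrite -{1}Qsym -trmx_mul Qs3 linearN linearZ scaleNr.
  by rewrite -trmx0 (inj_eq trmx_inj) -enorm_eq0 gt_eqF.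
have n1_gt0 := enorm_gt0 s1_neq0.
apply: contrapT => nopole.
have [B [d [BB Bd]]] := symmetric_eigenframe Qsym.
(* The gradient equation in frame coordinates, left without division since [d j + sigma * enorm s]
   may vanish. *)
have coord s : stationary c Q sigma s -> forall j,
    (B *m c) j 0 + (d j + sigma * enorm s) * (B *m s) j 0 = 0.
  move=> st j; have /(congr1 (fun v => (B *m v) j 0)) := st.
  rewrite /grad_cubic mulmx0 !mulmxDr -scalemxAr mulmxA !mxE.
  have -> : \sum_k (B *m Q) j k * s k 0 = d j * \sum_k B j k * s k 0.
    rewrite mulr_sumr; apply: eq_bigr => k _.
    by have /rowP/(_ k) := Bd j; rewrite -row_mul !mxE => ->; rewrite mulrA.
  by move=> eq0; apply: etrans eq0; ring.
pose l (s : 'cV[R]_n) := sigma * enorm s.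
pose gap j := (l s3 - l s2) * ((B *m s1) j 0 / l s1) ^+ 2
  + (l s2 - l s1) * ((B *m s3) j 0 / l s3) ^+ 2
  - (l s3 - l s1) * ((B *m s2) j 0 / l s2) ^+ 2.
have [l12 l23] : l s1 < l s2 /\ l s2 < l s3 by rewrite !ltr_pM2l.
have gap_gt0 j : (B *m s2) j 0 != 0 -> 0 < gap j.
  move=> xj; rewrite subr_gt0.
  apply: (@secular_term_convex _ (d j) ((B *m c) j 0)); try exact: coord;
    rewrite ?mulr_gt0 //.
  apply/negP => pole; apply: nopole; exists (d j); split => //.
  (* A zero row would make the [j]-th coordinate of [s2] vanish. *)
  apply/eigenvalueP; exists (row j B) => //; apply: contra xj => /eqP row0.
  have := congr1 (fun v => (v *m s2) 0 0) row0.
  by rewrite -row_mul mxE mul0mx [in RHS]mxE => ->.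
have gap_ge0 j : 0 <= gap j.
  have [xj|/gap_gt0/ltW//] := eqVneq ((B *m s2) j 0) 0.
  rewrite /gap xj mul0r expr0n mulr0 subr0.
  by rewrite addr_ge0 // mulr_ge0 ?sqr_ge0 // subr_ge0 ltW.
have sum_sqr s : 0 < enorm s -> \sum_j ((B *m s) j 0 / l s) ^+ 2 = sigma ^- 2.
  move=> s_gt0; under eq_bigr do rewrite exprMn.
  rewrite -mulr_suml eigenframe_dot //.
  by rewrite /l; field; rewrite !lt0r_neq0.
have gap_sum : \sum_j gap j = 0.
  rewrite sumrB big_split /= -!mulr_sumr !sum_sqr //; ring.
(* Nonnegative gaps with sum zero all vanish, which forces every coordinate of [s2] to be zero,
   against [0 < enorm s2]. *)
have gap0 := (psumr_eq0P (fun j _ => gap_ge0 j) gap_sum).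
have := eigenframe_dot s2 BB; rewrite big1 => [/esym/eqP|j _].
  by rewrite sqrf_eq0 gt_eqF.
have [->|/gap_gt0] := eqVneq ((B *m s2) j 0) 0; first by rewrite expr0n.
by rewrite gap0 // ltxx.
Qed.

(** * Counting the norms of stationary points *)

Lemma size_le_fibers (T : Type) (J : finType) (f : T -> J) (s : seq T)
    (m : nat) :
  (forall j, count (fun x => f x == j) s <= m)%N -> (size s <= m * #|J|)%N.
Proof.
move=> fib; rewrite -sum1_size (partition_big f xpredT) //= mulnC.
rewrite -sum_nat_const.
by apply: leq_sum => j _; rewrite sum1_count.
Qed.

Lemma count_lt (T : eqType) (p q : pred T) (s : seq T) (x : T) :
  x \in s -> q x -> ~~ p x -> subpred p q -> (count p s < count q s)%N.
Proof.
move=> xs qx npx pq; apply: (@leq_trans (count (predU p (pred1 x)) s)).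
  have := count_predUI p (pred1 x) s; rewrite (@eq_count _ (predI _ _) pred0).
    by rewrite count_pred0 addn0 => ->;
      rewrite -addn1 leq_add2l -has_count has_pred1.
  by move=> y /=; apply: contraNF npx => /andP[py /eqP <-].
by apply: sub_count => y /= /orP[/pq//|/eqP ->].
Qed.

Lemma stationary_norms_size (R : realType) (n : nat) (c : 'cV[R]_n)
    (Q : 'M[R]_n) (sigma : R) (k : nat) (ls : seq R) :
  Q^T = Q -> 0 < sigma -> neg_eigenvalues Q #= `I_k -> uniq ls ->
  (forall l, l \in ls -> exists2 s, stationary c Q sigma s & enorm s = l) ->
  (size ls <= 2 * (k + 1))%N.
Proof.
move=> Qsym sigma_gt0 /card_set_bijP[g [gfun ginj _]].
move=> ls_uniq ls_st.
(* [g] numbers the negative eigenvalues; counting the poles not above [sigma * l] gives a value from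
   0 to [k], which names the piece containing [l]. *)
pose below l i :=
  `[< exists a, [/\ neg_eigenvalues Q a, g a = i & - a <= sigma * l] >].
have below_lt l : (count (below l) (iota 0 k) < k.+1)%N.
  by rewrite ltnS (leq_trans (count_size _ _)) // size_iota.
pose f l : 'I_k.+1 := Ordinal (below_lt l).
rewrite addn1 -(card_ord k.+1); apply: (size_le_fibers (f := f)) => v.
rewrite -size_filter leqNgt; apply/negP.
set t := filter _ _; rewrite -(size_sort <=%O).
(* Three norms in one piece, taken in increasing order, are to be refuted. *)
have := sort_lt_sorted t; rewrite filter_uniq //.
have := mem_sort <=%O t; case: (sort _ t) => [|l1 [|l2 [|l3 t']]] // memt.
move=> /= /and3P[l12 l23 _] _.
have tP l : l \in [:: l1, l2, l3 & t'] ->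
    f l = v /\ exists2 s, stationary c Q sigma s & enorm s = l.
  by rewrite memt mem_filter => /andP[/eqP -> /ls_st].
have [|f1 [s1 st1 e1]] := tP l1; first by rewrite !inE eqxx.
have [|_ [s2 st2 e2]] := tP l2; first by rewrite !inE eqxx orbT.
have [|f3 [s3 st3 e3]] := tP l3; first by rewrite !inE eqxx !orbT.
rewrite -e1 -e2 -e3 in l12 l23 f1 f3.
have [a [aQ /andP[a1 a3]]] :=
  stationary_triple_eigenvalue Qsym sigma_gt0 st1 st2 st3 l12 l23.
have a_neg : neg_eigenvalues Q a.
  split => //; rewrite -oppr_gt0; apply: le_lt_trans a1.
  by rewrite mulr_ge0 ?enorm_ge0 // ltW.
(* The pole [- a] is counted for [s3] but not for [s1], so their pieces differ. *)
have : (count (below (enorm s1)) (iota 0 k) <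
        count (below (enorm s3)) (iota 0 k))%N.
  apply: (@count_lt _ _ _ _ (g a)).
  - by rewrite mem_iota; exact: gfun.
  - by apply/asboolP; exists a.
  - apply/asboolP => -[b [b_neg gba ble]].
    have ab : b = a by apply: ginj gba; rewrite inE.
    by move: ble; rewrite ab leNgt a1.
  move=> i /asboolP[b [b_neg gb ble]]; apply/asboolP; exists b; split => //.
  by rewrite (le_trans ble) // ler_pM2l // ltW // (lt_trans l12).
by have := congr1 val (etrans f1 (esym f3)); rewrite /f /= => ->; rewrite ltnn.
Qed.

(** * Executions of the strategy: length and termination *)

Lemma local_output_exists (R : realType) (n : nat) (c : 'cV[R]_n)
    (Q : 'M[R]_n) (sigma : R) (L : 'cV[R]_n -> (nat -> 'cV[R]_n) -> Prop)
    (x : 'cV[R]_n) :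
  local_algorithm c Q sigma L -> exists y, local_output c Q sigma L x y.
Proof.
case=> Ltot _ Lstat _; have [u Lu] := Ltot x.
have exN : exists N, `[< stationary c Q sigma (u N) >].
  by have [N st] := Lstat x u Lu; exists N; apply/asboolP.
exists (u (ex_minn exN)), u, (ex_minn exN); split => //.
case: ex_minnP => N /asboolP stN minN; split => // i iN sti.
by have := minN i (asboolT sti); rewrite leqNgt iN.
Qed.

Lemma strategy_stationary (R : realType) (n : nat) (c : 'cV[R]_n)
    (Q : 'M[R]_n) (sigma : R) (L : 'cV[R]_n -> (nat -> 'cV[R]_n) -> Prop)
    (x0 : 'cV[R]_n) (j : nat) (s : 'cV[R]_n) :
  strategy c Q sigma L x0 j s -> stationary c Q sigma s.
Proof.
by case=> [y [u [N [_ [st _] ->]]]|i y z w _ _ [u [N [_ [st _] ->]]]].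
Qed.

(** The bound on model values is the induction invariant: each round strictly lowers the value, and
    the value depends only on the norm, so no norm recurs. *)
Lemma strategy_norms (R : realType) (n : nat) (c : 'cV[R]_n)
    (Q : 'M[R]_n) (sigma : R) (L : 'cV[R]_n -> (nat -> 'cV[R]_n) -> Prop)
    (x0 : 'cV[R]_n) (j : nat) (s : 'cV[R]_n) :
  Q^T = Q -> 0 < sigma -> local_algorithm c Q sigma L ->
  strategy c Q sigma L x0 j s ->
  exists ls : seq R, [/\ size ls = j, uniq ls &
    forall l, l \in ls -> exists2 t, stationary c Q sigma t &
      enorm t = l /\ cubic_model c Q sigma s <= cubic_model c Q sigma t].
Proof.
move=> Qsym sigma_gt0 [_ _ _ Lle] str.
elim: j s / str => [s out|j s sh s' str [ls [sz ls_uniq lsP]] esc out].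
  exists [:: enorm s]; split => // l; rewrite inE => /eqP ->; exists s => //.
  exact: strategy_stationary (strategy_start out).
have sts' := strategy_stationary (strategy_next str esc out).
have lt_s : cubic_model c Q sigma s' < cubic_model c Q sigma s.
  apply: le_lt_trans (escape_lt Qsym sigma_gt0 (strategy_stationary str) esc).
  by case: out => u [N [Lu fst ->]]; exact: Lle Lu fst.
exists (enorm s' :: ls); split => [| |l]; first by rewrite /= sz.
  rewrite /= ls_uniq andbT; apply/negP => /lsP[t stt [et le_t]].
  have := lt_le_trans lt_s le_t.
  by rewrite (cubic_model_eq_enorm Qsym stt sts' et) ltxx.
rewrite inE => /predU1P[->|/lsP[t stt [et le_t]]]; first by exists s'.
by exists t => //; split => //; rewrite (le_trans (ltW lt_s)).
Qed.

Lemma strategy_bound (R : realType) (n : nat) (c : 'cV[R]_n)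
    (Q : 'M[R]_n) (sigma : R) (k : nat)
    (L : 'cV[R]_n -> (nat -> 'cV[R]_n) -> Prop)
    (x0 : 'cV[R]_n) (j : nat) (s : 'cV[R]_n) :
  Q^T = Q -> 0 < sigma -> neg_eigenvalues Q #= `I_k ->
  local_algorithm c Q sigma L ->
  strategy c Q sigma L x0 j s -> (j <= 2 * (k + 1))%N.
Proof.
move=> Qsym sigma_gt0 card_k Lalg str.
have [ls [<- ls_uniq lsP]] := strategy_norms Qsym sigma_gt0 Lalg str.
apply: (stationary_norms_size (c := c) Qsym sigma_gt0 card_k ls_uniq).
by move=> l /lsP[t stt [et _]]; exists t.
Qed.

Lemma strategy_progress (R : realType) (n : nat) (c : 'cV[R]_n)
    (Q : 'M[R]_n) (sigma : R) (L : 'cV[R]_n -> (nat -> 'cV[R]_n) -> Prop)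
    (x0 : 'cV[R]_n) (j : nat) (s : 'cV[R]_n) :
  0 < sigma -> local_algorithm c Q sigma L -> strategy c Q sigma L x0 j s ->
  strategy_returns c Q sigma L x0 j s \/
  exists s', strategy c Q sigma L x0 j.+1 s'.
Proof.
move=> sigma_gt0 Lalg str.
have [AB|nAB] := pselect (condA c s \/ condB c Q sigma s); last first.
  by left; split => // ?; apply: nAB; [left | right].
right; have [sh esc] := escape_exists sigma_gt0 AB.
have [s' out] := local_output_exists sh Lalg.
by exists s'; exact: strategy_next str esc out.
Qed.

(** If no execution returned, [strategy_progress] would extend one to any length, past
    [strategy_bound]. *)
Lemma strategy_returns_exists (R : realType) (n : nat) (c : 'cV[R]_n)
    (Q : 'M[R]_n) (sigma : R) (k : nat)
    (L : 'cV[R]_n -> (nat -> 'cV[R]_n) -> Prop) (x0 : 'cV[R]_n) :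
  Q^T = Q -> 0 < sigma -> neg_eigenvalues Q #= `I_k ->
  local_algorithm c Q sigma L ->
  exists j s, strategy_returns c Q sigma L x0 j s.
Proof.
move=> Qsym sigma_gt0 card_k Lalg; apply: contrapT => noret.
have run j : exists s, strategy c Q sigma L x0 j.+1 s.
  elim: j => [|j [s /(strategy_progress sigma_gt0 Lalg) [ret|//]]]; last first.
    by case: noret; exists j.+1, s.
  by have [s out] := local_output_exists x0 Lalg; exists s;
    exact: strategy_start.
have [s str] := run (2 * (k + 1))%N.
by have := strategy_bound Qsym sigma_gt0 card_k Lalg str; rewrite ltnn.
Qed.

Theorem mainTheorem5 (R : realType) (n : nat) (c : 'cV[R]_n) (Q : 'M[R]_n)
    (sigma : R) (k : nat) (L : 'cV[R]_n -> (nat -> 'cV[R]_n) -> Prop)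
    (Qsym : Q^T = Q) (sigma_gt0 : 0 < sigma)
    (card_k : neg_eigenvalues Q #= `I_k)
    (Lalg : local_algorithm c Q sigma L) :
  (* a stationary point satisfying neither (A) nor (B) is a global minimizer *)
  (forall s : 'cV[R]_n, stationary c Q sigma s ->
     ~ condA c s -> ~ condB c Q sigma s -> global_minimizer c Q sigma s) /\
  (* otherwise the escape step is possible, for any choice of d in case (B), *)
  (forall s : 'cV[R]_n, stationary c Q sigma s ->
     condA c s \/ condB c Q sigma s -> exists sh, escape c Q sigma s sh) /\
  (forall s d : 'cV[R]_n, stationary c Q sigma s ->
     dot c s <= 0 -> quad (shifted Q sigma s) d < 0 ->
     exists sh, escapeB c Q sigma s d sh) /\
  (* and it strictly decreases the model *)
  (forall s sh : 'cV[R]_n, stationary c Q sigma s -> escape c Q sigma s sh ->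
     cubic_model c Q sigma sh < cubic_model c Q sigma s) /\
  (* every execution computes at most 2 (k + 1) stationary points, *)
  (forall (x0 : 'cV[R]_n) (j : nat) (s : 'cV[R]_n),
     strategy c Q sigma L x0 j s -> (j <= 2 * (k + 1))%N) /\
  (* never gets stuck before returning, *)
  (forall (x0 : 'cV[R]_n) (j : nat) (s : 'cV[R]_n),
     strategy c Q sigma L x0 j s ->
     strategy_returns c Q sigma L x0 j s \/
     exists s' : 'cV[R]_n, strategy c Q sigma L x0 j.+1 s') /\
  (* returns only global minimizers, *)
  (forall (x0 : 'cV[R]_n) (j : nat) (s : 'cV[R]_n),
     strategy_returns c Q sigma L x0 j s -> global_minimizer c Q sigma s) /\
  (* and a global minimizer is obtained, from any starting point *)
  (forall x0 : 'cV[R]_n, exists (j : nat) (s : 'cV[R]_n),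
     [/\ strategy_returns c Q sigma L x0 j s, (j <= 2 * (k + 1))%N
       & global_minimizer c Q sigma s]).
Proof.
have min s := @stationary_global_minimizer _ _ c Q _ s Qsym sigma_gt0.
have retmin x0 j s : strategy_returns c Q sigma L x0 j s ->
    global_minimizer c Q sigma s.
  by case=> /strategy_stationary; exact: min.
split=> //; split; first by move=> s _; exact: escape_exists.
split; first by move=> s d _ _; exact: escapeB_exists.
split; first by move=> s sh; exact: escape_lt.
have bound x0 j s : strategy c Q sigma L x0 j s -> (j <= 2 * (k + 1))%N.
  exact: strategy_bound.
split=> //; split; first by move=> x0 j s; exact: strategy_progress.
split=> // x0.
have [j [s ret]] := strategy_returns_exists x0 Qsym sigma_gt0 card_k Lalg.
by exists j, s; split => //; [case: ret => /bound | exact: retmin ret].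
Qed.
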